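(* Let $\alpha>1$, $0<\beta<1$ and $0<\phi<1$. If $\gamma$ is sufficiently large (i.e. there is $\gamma_*\ge 0$ depending on $\alpha,\beta,\phi$ such that the following holds for all $\gamma>\gamma_*$), then the left-pushed beta density $x\mapsto\text{LPushBeta}(x|\alpha,\beta,\gamma,\phi)$ is neither quasi-concave nor quasi-convex. In this case, as $x$ increases over $(0,1)$, the slope of the density starts positive, turns negative, then turns positive again.
   Context: For $\alpha>0$, $\beta>0$, $\gamma\ge 0$, $0\le\phi\le 1$, the left-pushed beta density is $$\text{LPushBeta}(x|\alpha,\beta,\gamma,\phi)=\frac{x^{\alpha-1}(1-x)^{\beta-1}(1-x\phi)^{\gamma}}{\int_0^1 t^{\alpha-1}(1-t)^{\beta-1}(1-t\phi)^{\gamma}\,dt},\qquad 0\le x\le 1.$$ A function $f$ is quasi-concave if $f(\lambda x+(1-\lambda)y)\ge\min(f(x),f(y))$, and quasi-convex if $f(\lambda x+(1-\lambda)y)\le\max(f(x),f(y))$, for all $x,y$ and $0\le\lambda\le1$. *)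

(* Defs.v *)
From HB Require Import structures.
From mathcomp Require Import all_boot all_order all_algebra.
From mathcomp Require Import all_classical all_reals all_analysis.

Set Implicit Arguments.
Unset Strict Implicit.
Unset Printing Implicit Defensive.

Import Order.TTheory GRing.Theory Num.Theory.
Import numFieldNormedType.Exports.

Local Open Scope classical_set_scope.
Local Open Scope ring_scope.

(* [powR 0 r] is 0 for r < 0, so at an endpoint where the true kernel is
   infinite (x = 0 if a < 1, x = 1 if b < 1) this one is 0. Endpoints are
   negligible for the integral below, but pointwise statements should stay in
   `]0, 1[. *)
Definition lpush_beta_kernel (R : realType) (a b g phi x : R) : R :=
  x `^ (a - 1) * (1 - x) `^ (b - 1) * (1 - x * phi) `^ g.

Definition lpush_beta (R : realType) (a b g phi x : R) : R :=
  lpush_beta_kernel a b g phi x /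
  \int[lebesgue_measure]_(t in `[0, 1]) lpush_beta_kernel a b g phi t.

Definition quasi_concave_on (R : realType) (D : set R) (f : R -> R) : Prop :=
  forall x y l : R, D x -> D y -> 0 <= l <= 1 ->
    Num.min (f x) (f y) <= f (l * x + (1 - l) * y).

Definition quasi_convex_on (R : realType) (D : set R) (f : R -> R) : Prop :=
  forall x y l : R, D x -> D y -> 0 <= l <= 1 ->
    f (l * x + (1 - l) * y) <= Num.max (f x) (f y).

(* Main.v *)
Require Import Defs.
From HB Require Import structures.
From mathcomp Require Import all_boot all_order all_algebra.
From mathcomp Require Import all_classical all_reals all_analysis.
From mathcomp Require Import measurable_realfun.
From mathcomp Require Import ring lra.

(** The logarithmic derivative of the kernel on ]0, 1[ is
    (a - 1) / x + (1 - b) / (1 - x) - g phi / (1 - x phi),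
    a positive factor times a quadratic q with q 0 = a - 1 > 0 and
    q 1 = (1 - b)(1 - phi) > 0. For large g, q is convex and q (1/2) < 0, so
    it has two roots r < 1/2 < s in ]0, 1[ and the density rises, falls and
    rises again. The peak at r refutes quasi-convexity, the valley at s
    refutes quasi-concavity. The normalising integral must be shown finite and
    positive, as a divergent one would be read as 0. *)

Set Implicit Arguments.
Unset Strict Implicit.
Unset Printing Implicit Defensive.

Import Order.TTheory GRing.Theory Num.Theory.
Import numFieldNormedType.Exports.

Local Open Scope classical_set_scope.
Local Open Scope ring_scope.

(** * Roots of a convex quadratic *)

(** A negative value at [c] makes the discriminant positive and puts [c] strictly between the roots.
    As 0 and 1 lie on either side of [c], positive values there force the roots into ]0, 1[. *)
Lemma quadratic_two_roots (R : rcfType) (A B C c : R) : 0 < A -> 0 < c < 1 ->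
  0 < C -> A * c ^+ 2 + B * c + C < 0 -> 0 < A + B + C ->
  exists r s : R, [/\ 0 < r, r < s & s < 1] /\
    forall x, A * x ^+ 2 + B * x + C = A * (x - r) * (x - s).
Proof.
move=> A0 /andP[c0 c1] C0 qc q1.
have A_neq0 : A != 0 by rewrite gt_eqF.
pose D := B ^+ 2 - 4 * A * C.
have D_gt0 : 0 < D.
  (* Completing the square at [c]: the discriminant is a square minus [4 * A] times the negative
     value at [c]. *)
  have Dc : D = (2 * A * c + B) ^+ 2 - 4 * A * (A * c ^+ 2 + B * c + C).
    by rewrite /D; ring.
  have := sqr_ge0 (2 * A * c + B).
  have : 0 < - (A * (A * c ^+ 2 + B * c + C)) by rewrite -mulrN mulr_gt0 ?oppr_gt0.
  by rewrite Dc; lra.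
pose d := Num.sqrt D.
have d0 : 0 < d by rewrite sqrtr_gt0.
have dd : d ^+ 2 = D by rewrite sqr_sqrtr ?ltW.
pose r := (- B - d) / (2 * A); pose s := (- B + d) / (2 * A).
have qE x : A * x ^+ 2 + B * x + C = A * (x - r) * (x - s).
  (* Eliminating [C] in favour of [d] turns the factorisation into a rational identity in [A], [B],
     [d], [x], which [field] can check without knowing that [d] is a square root. *)
  have -> : C = (B ^+ 2 - d ^+ 2) / (4 * A) by rewrite dd /D; field.
  by rewrite /r /s; field.
have rs : r < s by rewrite ltr_pM2r ?invr_gt0 ?mulr_gt0 //; lra.
have cr : r < c.
  rewrite ltNge; apply/negP => cr; suff : 0 <= A * (c - r) * (c - s).
    by rewrite -qE; lra.
  rewrite -mulrA pmulr_rge0 // mulr_le0 //; lra.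
have cs : c < s.
  rewrite ltNge; apply/negP => sc; suff : 0 <= A * (c - r) * (c - s).
    by rewrite -qE; lra.
  by rewrite -mulrA pmulr_rge0 // mulr_ge0; lra.
exists r, s; split => //; split => //.
- have : 0 < A * (0 - r) * (0 - s) by rewrite -qE; lra.
  by rewrite -mulrA pmulr_rgt0// !sub0r mulrNN pmulr_lgt0//; lra.
- have : 0 < A * (1 - r) * (1 - s) by rewrite -qE; lra.
  by rewrite -mulrA pmulr_rgt0// pmulr_rgt0; lra.
Qed.

(** * Obstructions to quasi-concavity and quasi-convexity *)

Lemma convex_comb_between (R : realFieldType) (x y z : R) : x < y -> y < z ->
  exists2 l : R, 0 <= l <= 1 & y = l * x + (1 - l) * z.
Proof.
move=> xy yz; have zx : 0 < z - x by lra.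
exists ((z - y) / (z - x)); last by field; rewrite gt_eqF.
by rewrite divr_ge0 ?ler_pdivrMr//= ?mul1r; lra.
Qed.

Lemma valley_not_quasi_concave (R : realType) (D : set R) (f : R -> R) x y z :
  D x -> D z -> x < y -> y < z -> f y < f x -> f y < f z ->
  ~ quasi_concave_on D f.
Proof.
move=> Dx Dz xy yz fyx fyz qf.
have [l l01 yE] := convex_comb_between xy yz.
by have := qf x z l Dx Dz l01; rewrite -yE leNgt lt_min fyx fyz.
Qed.

Lemma peak_not_quasi_convex (R : realType) (D : set R) (f : R -> R) x y z :
  D x -> D z -> x < y -> y < z -> f x < f y -> f z < f y ->
  ~ quasi_convex_on D f.
Proof.
move=> Dx Dz xy yz fyx fyz qf.
have [l l01 yE] := convex_comb_between xy yz.
by have := qf x z l Dx Dz l01; rewrite -yE leNgt gt_max fyx fyz.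
Qed.

(** * Derivative of the kernel *)

Lemma powR_subr1 (R : realType) (x c : R) : 0 < x -> x `^ (c - 1) = x `^ c / x.
Proof. by move=> x0; rewrite powRB ?powRr1 ?ltW// (gt_eqF x0) implybT. Qed.

Lemma is_derive1_onemM_powR (R : realType) (k c x : R) : 0 < 1 - x * k ->
  is_derive x 1 (fun t => (1 - t * k) `^ c)
    (c * (1 - x * k) `^ (c - 1) * - k).
Proof.
move=> xk; apply: (@is_derive1_comp _ (@powR R ^~ c) (fun t => 1 - t * k)).
  exact: is_derive1_powR.
have -> : (fun t => 1 - t * k) = cst 1 - k \*: id.
  by apply/funext => t; rewrite !fctE mulrC.
by apply: is_derive_eq; rewrite [_ *: _]mulr1 sub0r.
Qed.

Lemma is_derive1_onem_powR (R : realType) (c x : R) : x < 1 ->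
  is_derive x 1 (fun t => (1 - t) `^ c) (- (c * (1 - x) `^ (c - 1))).
Proof.
move=> x1; have := @is_derive1_onemM_powR R 1 c x.
rewrite mulr1 mulrN1 subr_gt0; under eq_fun do rewrite mulr1; exact.
Qed.

Lemma is_derive1_lpush_beta_kernel (R : realType) (a b g phi x : R) :
  0 < x < 1 -> 0 < phi < 1 ->
  is_derive x 1 (lpush_beta_kernel a b g phi)
    (lpush_beta_kernel a b g phi x / (x * (1 - x) * (1 - x * phi)) *
     ((a + b - 2 + g) * phi * x ^+ 2
      + (1 - b - (a - 1) * (1 + phi) - g * phi) * x + (a - 1))).
Proof.
move=> /andP[x0 x1] /andP[p0 p1].
have xp : 0 < 1 - x * phi by rewrite subr_gt0 mulr_ilt1 ?ltW.
have x1' : 0 < 1 - x by rewrite subr_gt0.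
have d1 := is_derive1_powR (a - 1) x0.
have d2 := @is_derive1_onem_powR _ (b - 1) x x1.
have d3 := @is_derive1_onemM_powR _ phi g x xp.
have -> : lpush_beta_kernel a b g phi = (@powR R ^~ (a - 1)) *
    (fun t => (1 - t) `^ (b - 1)) * (fun t => (1 - t * phi) `^ g) by [].
apply: is_derive_eq; rewrite /GRing.scale/= !fctE.
(* Once each lowered exponent is a division by the base, the real powers are atoms for [field]. *)
rewrite !powR_subr1//.
by field; rewrite !gt_eqF.
Qed.

(** * The normalising integral is finite and positive *)

Lemma integral_onem_powR_le (R : realType) (b s : R) : 0 < b -> 0 < s < 1 ->
  (\int[lebesgue_measure]_(t in `[0%R, s]) ((1 - t) `^ (b - 1))%R%:E <= b^-1%:E)%E.
Proof.
move=> b0 /andP[s0 s1].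
have dF (x : R) : x < 1 -> is_derive x 1 (fun t : R => - b^-1 * (1 - t) `^ b)
    ((1 - x) `^ (b - 1)).
  move=> x1; have dp := is_derive1_onem_powR b x1.
  have -> : (fun t : R => - b^-1 * (1 - t) `^ b) =
      (- b^-1) \*: (fun t => (1 - t) `^ b) by [].
  by apply: is_derive_eq; rewrite /GRing.scale/=; field; rewrite gt_eqF.
have cF (x : R) : x < 1 -> {for x, continuous (fun t : R => - b^-1 * (1 - t) `^ b)}.
  move=> /dF[d _]; apply/differentiable_continuous.
  by rewrite -derivable1_diffP.
rewrite (@continuous_FTC2 _ _ (fun t : R => - b^-1 * (1 - t) `^ b)) //.
- rewrite -EFinB lee_fin subr0 powR1 mulr1 opprK gerDr.
  by rewrite mulNr oppr_le0 mulr_ge0 ?powR_ge0// invr_ge0 ltW.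
- apply: derivable_within_continuous => x; rewrite in_itv/= => /andP[_ xs].
  by have [] := is_derive1_onem_powR (b - 1) (le_lt_trans xs s1).
- split => [x||].
  + rewrite in_itv/= => /andP[_ xs].
    by have [] := dF _ (lt_trans xs s1).
  + by apply: cvg_at_right_filter; exact: cF.
  + by apply: cvg_at_left_filter; exact: cF.
- move=> x; rewrite in_itv/= => /andP[_ xs].
  by have [_ <-] := dF _ (lt_trans xs s1); rewrite derive1E.
Qed.

Lemma measurable_onemM_powR (R : realType) (k c : R) (D : set R) :
  measurable D -> measurable_fun D (fun t : R => (1 - t * k) `^ c).
Proof.
move=> mD.
apply: (@measurableT_comp _ _ _ _ _ _ (@powR R ^~ c)) => //.
by apply: measurable_funB => //; exact: measurable_funM.
Qed.

Lemma measurable_lpush_beta_kernel (R : realType) (a b g phi : R) (D : set R) :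
  measurable D -> measurable_fun D (lpush_beta_kernel a b g phi).
Proof.
move=> mD; apply: measurable_funM; last exact: measurable_onemM_powR.
apply: measurable_funM; first exact: measurable_funTS.
have := @measurable_onemM_powR _ 1 (b - 1) _ mD.
by under eq_fun do rewrite mulr1.
Qed.

Lemma lpush_beta_kernel_ge0 (R : realType) (a b g phi x : R) :
  0 <= lpush_beta_kernel a b g phi x.
Proof. by rewrite !mulr_ge0 ?powR_ge0. Qed.

Lemma lpush_beta_kernel_gt0 (R : realType) (a b g phi x : R) :
  0 < phi < 1 -> 0 < x < 1 -> 0 < lpush_beta_kernel a b g phi x.
Proof.
move=> /andP[p0 p1] /andP[x0 x1].
by rewrite !mulr_gt0 ?powR_gt0// subr_gt0// mulr_ilt1// ltW.
Qed.

Lemma powR_le1 (R : realType) (x c : R) : 0 <= x <= 1 -> 0 <= c -> x `^ c <= 1.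
Proof.
move=> /andP[x0 x1] c0; have -> : 1 = 1 `^ c :> R by rewrite powR1.
by apply: ge0_ler_powR => //; rewrite nnegrE.
Qed.

(** The two other factors are powers of numbers in [0, 1] with nonnegative exponents, hence at most
    1. *)
Lemma lpush_beta_kernel_le (R : realType) (a b g phi x : R) :
  1 <= a -> 0 <= g -> 0 <= phi <= 1 -> 0 <= x <= 1 ->
  lpush_beta_kernel a b g phi x <= (1 - x) `^ (b - 1).
Proof.
move=> a1 g0 /andP[p0 p1] /andP[x0 x1].
rewrite /lpush_beta_kernel -[leRHS]mul1r -[leRHS]mulr1.
rewrite ler_pM ?mulr_ge0 ?powR_ge0//.
  by rewrite ler_wpM2r ?powR_ge0// powR_le1 ?subr_ge0// x0.
by rewrite powR_le1// subr_ge0 lerBlDr lerDl mulr_ge0// mulr_ile1.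
Qed.

(** Exhaustion by intervals that stay away from 1. The shift [n.+2] keeps every right endpoint
    strictly inside ]0, 1[, as [integral_onem_powR_le] requires. *)
Lemma itv01_bigcup (R : realType) :
  `[0, 1[%classic = \bigcup_n `[0, 1 - n.+2%:R^-1]%classic :> set R.
Proof.
apply/seteqP; split => x /=.
  rewrite in_itv/= => /andP[x0 x1].
  have /ltW xn := truncnS_gt (1 - x)^-1.
  exists (Num.trunc (1 - x)^-1) => //=; rewrite in_itv/= x0/=.
  rewrite lerBrDl -lerBrDr -[leRHS]invrK lef_pV2 ?posrE ?invr_gt0 ?subr_gt0//.
  by rewrite (le_trans xn)// ler_nat.
move=> [n _] /=; rewrite !in_itv/= => /andP[-> xn].
by rewrite (le_lt_trans xn)// ltrBlDr ltrDl invr_gt0.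
Qed.

(** Monotone convergence: the uniform bound on the exhausting intervals passes to the limit, and the
    endpoint 1 is negligible. *)
Lemma integral_lpush_beta_kernel_le (R : realType) (a b g phi : R) :
  1 <= a -> 0 < b -> 0 <= g -> 0 <= phi <= 1 ->
  (\int[lebesgue_measure]_(t in `[0%R, 1%R]) (lpush_beta_kernel a b g phi t)%:E
   <= b^-1%:E)%E.
Proof.
move=> a1 b0 g0 phi01.
have mk (D : set R) : measurable D ->
    measurable_fun D (EFin \o lpush_beta_kernel a b g phi).
  by move=> mD; apply/measurable_EFinP; exact: measurable_lpush_beta_kernel.
rewrite -integral_itv_bndo_bndc; last exact: mk.
rewrite itv01_bigcup.
set F := fun n : nat => `[0, 1 - n.+2%:R^-1]%classic : set R.
have F01 n x : F n x -> 0 <= x <= 1.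
  rewrite /F/= in_itv/= => /andP[-> /le_trans]; apply.
  by rewrite lerBlDr lerDl invr_ge0.
have ndF : nondecreasing_seq F.
  move=> m n mn; rewrite subsetEset => x; rewrite /F/= !in_itv/= => /andP[->/=].
  move=> /le_trans; apply; rewrite lerD2l lerN2 lef_pV2 ?posrE//.
  by rewrite ler_nat !ltnS.
have mF i : measurable (F i) by exact: measurable_itv.
have cvgI : (\int[lebesgue_measure]_(t in F n)
      (lpush_beta_kernel a b g phi t)%:E @[n --> \oo] -->
    \int[lebesgue_measure]_(t in \bigcup_n F n)
      (lpush_beta_kernel a b g phi t)%:E)%E.
  apply: ge0_nondecreasing_set_cvg_integral => // [i|_ x _]; first exact: mk.
  by rewrite lee_fin lpush_beta_kernel_ge0.
rewrite -(cvg_lim _ cvgI)//; apply: lime_le.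
  by apply/cvg_ex; eexists; exact: cvgI.
apply: nearW => n.
have n01 : 0 < (1 : R) - n.+2%:R^-1 < 1.
  by rewrite subr_gt0 invf_lt1 ?ltr1n// ltrBlDr ltrDl invr_gt0/=.
apply: le_trans (integral_onem_powR_le b0 n01).
apply: ge0_le_integral => //.
- exact: mF.
- by move=> x _; rewrite lee_fin lpush_beta_kernel_ge0.
- exact: mk.
- apply/measurable_EFinP.
  have := @measurable_onemM_powR _ 1 (b - 1) _ (mF n).
  by under eq_fun do rewrite mulr1.
- by move=> x /F01 x01; rewrite lee_fin lpush_beta_kernel_le.
Qed.

Lemma Rintegral_lpush_beta_kernel_gt0 (R : realType) (a b g phi : R) :
  1 <= a -> 0 < b <= 1 -> 0 <= g -> 0 < phi < 1 ->
  0 < \int[lebesgue_measure]_(t in `[0, 1]) lpush_beta_kernel a b g phi t.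
Proof.
move=> a1 /andP[b0 b1] g0 phi01; have /andP[p0 p1] := phi01.
have mk (D : set R) : measurable D ->
    measurable_fun D (EFin \o lpush_beta_kernel a b g phi).
  by move=> mD; apply/measurable_EFinP; exact: measurable_lpush_beta_kernel.
(* [fine] sends an infinite integral to 0, so finiteness is part of the goal. *)
rewrite /Rintegral fine_gt0//; apply/andP; split; last first.
  apply: le_lt_trans (integral_lpush_beta_kernel_le a1 b0 g0 _) (ltry _).
  by rewrite !ltW.
(* On [1/4, 1/2] the kernel is at least [c]: the outer factors are bounded below by the bases 1/4
   and [1 - phi], and the middle one is at least 1 because [b <= 1]. *)
pose c : R := 4^-1 `^ (a - 1) * (1 - phi) `^ g.
have c0 : 0 < c by rewrite mulr_gt0 ?powR_gt0// subr_gt0.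
have sub : [set` `[4^-1 : R, 2^-1]] `<=` [set` `[0 : R, 1]].
  by move=> x; rewrite /= !in_itv/= => /andP[? ?]; lra.
apply: (@lt_le_trans _ _ (\int[lebesgue_measure]_(t in `[4^-1%R, 2^-1%R]) c%:E)%E).
  rewrite integral_cst//= lebesgue_measure_itv/= lte_fin ifT; last by lra.
  by rewrite -EFinB -EFinM lte_fin mulr_gt0//; lra.
apply: (@le_trans _ _ (\int[lebesgue_measure]_(t in `[4^-1%R, 2^-1%R])
   (lpush_beta_kernel a b g phi t)%:E)%E); last first.
  apply: ge0_subset_integral => //; first exact: mk.
  by move=> x _; rewrite lee_fin lpush_beta_kernel_ge0.
apply: ge0_le_integral => //.
- by move=> x _; rewrite lee_fin ltW.
- exact: mk.
move=> x; rewrite /= in_itv/= => /andP[x4 x2]; rewrite lee_fin.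
have x0 : 0 < x by lra.
have x1 : x < 1 by lra.
apply: ler_pM; rewrite ?powR_ge0//; last first.
  apply: ge0_ler_powR; rewrite ?nnegrE ?subr_ge0 ?lerD2l ?lerN2//.
  + exact: ltW.
  + by rewrite mulr_ile1 ?ltW.
  + by rewrite ler_piMl// ltW.
rewrite -[leLHS]mulr1; apply: ler_pM; rewrite ?powR_ge0//.
  by apply: ge0_ler_powR; rewrite ?nnegrE ?subr_ge0//; lra.
rewrite -[b - 1]opprB powRN -[leLHS]invr1 lef_pV2 ?posrE ?powR_gt0 ?subr_gt0//.
by rewrite powR_le1 ?subr_ge0//; lra.
Qed.

(** * Sign of the slope of the density *)

(* The bound on g makes the quadratic negative at 1/2. *)
Lemma is_derive1_lpush_beta_factored (R : realType) (a b g phi : R) :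
  1 < a -> 0 < b < 1 -> 0 < phi < 1 -> 2 * (a - b) / phi < g ->
  exists r s : R, [/\ 0 < r, r < s & s < 1] /\
    forall x : R, 0 < x < 1 -> exists2 k : R, 0 < k &
      is_derive x 1 (lpush_beta a b g phi) (k * ((x - r) * (x - s))).
Proof.
move=> a1 b01 phi01 hg; have /andP[b0 b1] := b01; have /andP[p0 p1] := phi01.
have ab : 0 < a - b by lra.
have gphi : 2 * (a - b) < g * phi by rewrite -ltr_pdivrMr.
(* As [a + b - 2 + 2 * (a - b) = 3 * a - b - 2] is positive, this bound makes the leading
   coefficient [A] positive. *)
have gab : 2 * (a - b) < g.
  by apply: lt_trans hg; rewrite ltr_pdivlMr// gtr_pMr// mulr_gt0.
have g0 : 0 < g by lra.
pose A := (a + b - 2 + g) * phi.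
have A0 : 0 < A by rewrite mulr_gt0//; lra.
have abp : 0 < (a - b) * phi by rewrite mulr_gt0.
have bp : 0 < (1 - b) * (1 - phi) by rewrite mulr_gt0; lra.
have half01 : 0 < (2^-1 : R) < 1 by apply/andP; split; lra.
(* The value at 1/2 is [(2 * (a - b) - g * phi - (a - b) * phi) / 4], negative by [gphi] and [abp];
   the value at 1 is the product in [bp]. *)
have [|||r [s [rs qE]]] := quadratic_two_roots
    (B := 1 - b - (a - 1) * (1 + phi) - g * phi) (C := a - 1) A0 half01.
- by lra.
- by rewrite /A; lra.
- by rewrite /A; lra.
exists r, s; split => // x x01.
have Z0 : 0 < \int[lebesgue_measure]_(t in `[0, 1]) lpush_beta_kernel a b g phi t.
  by apply: Rintegral_lpush_beta_kernel_gt0 => //; rewrite ?b0 ltW.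
have d := is_derive1_lpush_beta_kernel a b g x01 phi01.
set Z := (\int[lebesgue_measure]_(t in _) _) in Z0.
have /andP[x0 x1] := x01.
have xp : 0 < 1 - x * phi by rewrite subr_gt0 mulr_ilt1 ?ltW.
exists (lpush_beta_kernel a b g phi x / (x * (1 - x) * (1 - x * phi)) * A / Z).
  have x1' : 0 < 1 - x by rewrite subr_gt0.
  by rewrite divr_gt0// mulr_gt0// divr_gt0 ?lpush_beta_kernel_gt0// !mulr_gt0.
have -> : lpush_beta a b g phi = Z^-1 \*: lpush_beta_kernel a b g phi.
  by apply/funext => t; exact: mulrC.
by apply: is_derive_eq; rewrite qE /GRing.scale/=; ring.
Qed.

Theorem mainTheorem9 (R : realType) (a b phi : R)
    (ha : 1 < a) (hb : 0 < b < 1) (hphi : 0 < phi < 1) :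
  exists2 gstar : R, 0 <= gstar & forall g : R, gstar < g ->
    [/\ ~ quasi_concave_on `]0, 1[ (lpush_beta a b g phi),
        ~ quasi_convex_on `]0, 1[ (lpush_beta a b g phi),
        (forall x : R, 0 < x < 1 -> derivable (lpush_beta a b g phi) x 1)
      & exists r s : R,
        [/\ 0 < r, r < s & s < 1] /\
        [/\ forall x : R, 0 < x < r -> 0 < derive1 (lpush_beta a b g phi) x,
            forall x : R, r < x < s -> derive1 (lpush_beta a b g phi) x < 0
          & forall x : R, s < x < 1 -> 0 < derive1 (lpush_beta a b g phi) x]].
Proof.
have ab : 0 <= a - b by have /andP[_ b1] := hb; lra.
have /andP[p0 _] := hphi.
exists (2 * (a - b) / phi); first by rewrite divr_ge0 ?mulr_ge0// ltW.
move=> g /(is_derive1_lpush_beta_factored ha hb hphi)[r [s [[r0 rs s1] dE]]].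
set f := lpush_beta a b g phi in dE *.
have df (x : R) : 0 < x < 1 -> derivable f x 1 by move=> /dE[k _ []].
have f'_gt0l (x : R) : 0 < x < r -> 0 < derive1 f x.
  move=> /andP[x0 xr]; have [|k k0 [_ f'x]] := dE x; first by apply/andP; lra.
  by rewrite derive1E f'x pmulr_rgt0// nmulr_lgt0; lra.
have f'_lt0 (x : R) : r < x < s -> derive1 f x < 0.
  move=> /andP[rx xs]; have [|k k0 [_ f'x]] := dE x; first by apply/andP; lra.
  by rewrite derive1E f'x pmulr_rlt0// pmulr_rlt0; lra.
have f'_gt0r (x : R) : s < x < 1 -> 0 < derive1 f x.
  move=> /andP[sx x1]; have [|k k0 [_ f'x]] := dE x; first by apply/andP; lra.
  by rewrite derive1E f'x pmulr_rgt0// pmulr_rgt0; lra.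
have df_itv (u v : R) : 0 < u -> v < 1 -> {in `[u, v], forall x, derivable f x 1}.
  move=> u0 v1 x; rewrite in_itv/= => /andP[ux xv].
  by apply: df; apply/andP; lra.
(* The sign is required only on the open interval, so the critical points [r] and [s] may serve as
   endpoints. *)
have f_incr (u v : R) : 0 < u -> u < v -> v < 1 ->
    (forall x, u < x < v -> 0 < derive1 f x) -> f u < f v.
  move=> u0 uv v1 f'; have dfi := df_itv _ _ u0 v1.
  have dfo x : x \in `]u, v[ -> derivable f x 1.
    by move=> /subset_itv_oo_cc; exact: dfi.
  have f'o x : x \in `]u, v[ -> 0 < derive1 f x.
    by rewrite in_itv; exact: f'.
  by apply: (gtr0_derive1_lt_cc dfo f'o (derivable_within_continuous dfi));
    rewrite ?in_itv/= ?lexx ?ltW.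
have f_decr (u v : R) : 0 < u -> u < v -> v < 1 ->
    (forall x, u < x < v -> derive1 f x < 0) -> f v < f u.
  move=> u0 uv v1 f'; have dfi := df_itv _ _ u0 v1.
  have dfo x : x \in `]u, v[ -> derivable f x 1.
    by move=> /subset_itv_oo_cc; exact: dfi.
  have f'o x : x \in `]u, v[ -> derive1 f x < 0.
    by rewrite in_itv; exact: f'.
  by apply: (ltr0_derive1_lt_cc dfo f'o (derivable_within_continuous dfi));
    rewrite ?in_itv/= ?lexx ?ltW.
have fsr : f s < f r by apply: f_decr.
split => //; last by exists r, s.
(* The right witness is the midpoint of [s] and 1, since 1 lies outside the domain and the formal
   density there takes the default value 0. *)
- apply: (@valley_not_quasi_concave _ _ _ r s ((s + 1) / 2)) => //=;
    rewrite ?in_itv/=; try lra.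
  apply: f_incr; try lra; move=> x /andP[sx x1]; apply: f'_gt0r.
  by apply/andP; lra.
- apply: (@peak_not_quasi_convex _ _ _ (r / 2) r s) => //=;
    rewrite ?in_itv/=; try lra.
  apply: f_incr; try lra; move=> x /andP[xr x1]; apply: f'_gt0l.
  by apply/andP; lra.
Qed.
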